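(* Let $f:[0,1]^2\to[0,1]$ be any aggregator. Then the function $\lambda\mapsto R_\lambda(f)$ on $(0,1]$ is single-troughed: it is either monotone, or there is a point $\lambda_0$ such that $R_\lambda(f)$ is monotonically non-increasing for $\lambda\le\lambda_0$ and monotonically non-decreasing for $\lambda\ge\lambda_0$.
   Context: Setting: a binary world state $\omega\in\{0,1\}$ and two experts. An information structure $\theta$ consists of a prior $\mu=\Pr[\omega=1]\in(0,1)$ and finite signal spaces $\mathcal S_1,\mathcal S_2$ with a joint distribution of $(\omega,S_1,S_2)$ under which $S_1$ and $S_2$ are conditionally independent given $\omega$; $\Theta$ denotes the set of all such conditionally independent structures. Given a base rate consideration degree $\lambda\in(0,1]$, expert $i$ receiving signal $s_i$ reports $$x_i(s_i,\lambda)=\frac{\mu^\lambda\Pr[S_i=s_i\mid\omega=1]}{\mu^\lambda\Pr[S_i=s_i\mid\omega=1]+(1-\mu)^\lambda\Pr[S_i=s_i\mid\omega=0]},$$ i.e. the posterior odds equal $(\mu/(1-\mu))^\lambda$ times the likelihood ratio; $\lambda=1$ is the Bayesian posterior. Write $\mathbf x(\mathbf s,\lambda)=(x_1(s_1,\lambda),x_2(s_2,\lambda))$. The benchmark $f^*(\mathbf s)=\Pr_\theta[\omega=1\mid S_1=s_1,S_2=s_2]$ is the Bayesian aggregator with full knowledge of $\theta$. The loss is the squared loss $L(y,\omega)=(y-\omega)^2$. The regret of an aggregator $f:[0,1]^2\to[0,1]$ at degree $\lambda$ is $$R_\lambda(f)=\sup_{\theta\in\Theta}\mathbb E_\theta\big[L(f(\mathbf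 x(\mathbf s,\lambda)),\omega)-L(f^*(\mathbf s),\omega)\big].$$ *)

(* Defs.v *)
From HB Require Import structures.
From mathcomp Require Import all_boot all_order all_algebra.
From mathcomp Require Import boolp classical_sets reals exp.
Set Implicit Arguments. Unset Strict Implicit. Unset Printing Implicit Defensive.
Import Order.TTheory GRing.Theory Num.Theory.
Local Open Scope ring_scope.
Local Open Scope classical_set_scope.

(* An information structure with signal spaces 'I_n1, 'I_n2 is given by its
   joint pmf  P w s1 s2 = Pr[omega = w, S1 = s1, S2 = s2]. *)
Section InfoStructure.
Variables (R : realType) (n1 n2 : nat) (P : bool -> 'I_n1 -> 'I_n2 -> R).

Definition pw (w : bool) : R := \sum_(s1 < n1) \sum_(s2 < n2) P w s1 s2.
Definition prior : R := pw true.
Definition marg1 (w : bool) (s1 : 'I_n1) : R := \sum_(s2 < n2) P w s1 s2.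
Definition marg2 (w : bool) (s2 : 'I_n2) : R := \sum_(s1 < n1) P w s1 s2.
Definition lik1 (w : bool) (s1 : 'I_n1) : R := marg1 w s1 / pw w.
Definition lik2 (w : bool) (s2 : 'I_n2) : R := marg2 w s2 / pw w.

Definition is_ci_info_structure : Prop :=
  (forall w s1 s2, 0 <= P w s1 s2) /\
  \sum_(w : bool) \sum_(s1 < n1) \sum_(s2 < n2) P w s1 s2 = 1 /\
  0 < prior < 1 /\
  (forall w s1 s2, P w s1 s2 / pw w = lik1 w s1 * lik2 w s2).

(* reports with base rate consideration degree lam *)
Definition report1 (lam : R) (s1 : 'I_n1) : R :=
  prior `^ lam * lik1 true s1 /
  (prior `^ lam * lik1 true s1 + (1 - prior) `^ lam * lik1 false s1).
Definition report2 (lam : R) (s2 : 'I_n2) : R :=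
  prior `^ lam * lik2 true s2 /
  (prior `^ lam * lik2 true s2 + (1 - prior) `^ lam * lik2 false s2).

Definition bayes_agg (s1 : 'I_n1) (s2 : 'I_n2) : R :=
  P true s1 s2 / (P true s1 s2 + P false s1 s2).

End InfoStructure.

Definition sqloss {R : realType} (y : R) (w : bool) : R :=
  (y - (if w then 1 else 0)) ^+ 2.

Definition exp_regret {R : realType} (f : R -> R -> R) (lam : R)
  (n1 n2 : nat) (P : bool -> 'I_n1 -> 'I_n2 -> R) : R :=
  \sum_(w : bool) \sum_(s1 < n1) \sum_(s2 < n2)
    P w s1 s2 * (sqloss (f (report1 P lam s1) (report2 P lam s2)) w
                 - sqloss (bayes_agg P s1 s2) w).

Definition regret {R : realType} (f : R -> R -> R) (lam : R) : R :=
  sup [set r : R | exists (n1 n2 : nat) (P : bool -> 'I_n1 -> 'I_n2 -> R),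
         is_ci_info_structure P /\ r = exp_regret f lam P].

(* Main.v *)
Require Import Defs.
From HB Require Import structures.
From mathcomp Require Import all_boot all_order all_algebra.
From mathcomp Require Import boolp classical_sets reals exp.
From mathcomp Require Import topology normedtype sequences.
From mathcomp Require Import ring lra.
Import Order.TTheory GRing.Theory Num.Theory.
Import numFieldNormedType.Exports.
Local Open Scope ring_scope.

(** If a change of degree from [lam] to [lam'] is accompanied by raising the prior
    odds to the power [lam / lam'], all reports, hence all values of the
    aggregator, stay the same. For fixed reports and likelihoods the regret is a
    convex function of the prior: the benchmark loss is a minimum of functions
    that are affine in the prior. The prior moves monotonically and continuously
    with the degree, so the worst-case regret, a supremum of such functions, is
    quasi-convex and lower semicontinuous in the degree. Quasi-convexity alone
    would not give monotonicity up to and including the trough on both sides. *)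

Definition is_likelihood {R : realType} {n : nat} (g : bool -> 'I_n -> R) :=
  (forall w s, 0 <= g w s) /\ forall w, \sum_(s < n) g w s = 1.

Definition ci_joint {R : realType} {n1 n2 : nat} (g1 : bool -> 'I_n1 -> R)
    (g2 : bool -> 'I_n2 -> R) (m : R) (w : bool) (s1 : 'I_n1) (s2 : 'I_n2) : R :=
  (if w then m else 1 - m) * (g1 w s1 * g2 w s2).

Definition odds_report {R : realType} (a b p q : R) : R := a * p / (a * p + b * q).

Definition cell_regret {R : realType} (y p q : R) : R :=
  p * ((y - 1) ^+ 2 - (p / (p + q) - 1) ^+ 2) + q * (y ^+ 2 - (p / (p + q)) ^+ 2).

(** The table [F] of aggregate forecasts is kept apart from [m], so that the prior can move while
    the reports stay fixed. *)
Definition prior_regret {R : realType} {n1 n2 : nat} (F : 'I_n1 -> 'I_n2 -> R)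
    (g1 : bool -> 'I_n1 -> R) (g2 : bool -> 'I_n2 -> R) (m : R) : R :=
  \sum_(s1 < n1) \sum_(s2 < n2) cell_regret (F s1 s2)
    (ci_joint g1 g2 m true s1 s2) (ci_joint g1 g2 m false s1 s2).

(* The odds of [tilt e m] are the [e]-th power of the odds of [m]. *)
Definition tilt {R : realType} (e m : R) : R := m `^ e / (m `^ e + (1 - m) `^ e).

(** * Regret contributed by one pair of signals *)

Section CellRegret.
Context {R : realType}.
Implicit Types y z p q t : R.

(** Bias-variance decomposition around the posterior [p / (p + q)]; on a null cell both sides
    vanish, whatever value the quotient takes. *)
Lemma cell_regretE {y p q} : 0 <= p -> 0 <= q ->
  cell_regret y p q = (p + q) * (y - p / (p + q)) ^+ 2.
Proof.
move=> p0 q0; rewrite /cell_regret.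
have [pq0|pq0] := eqVneq (p + q) 0; last by field.
have -> : p = 0 by lra.
have -> : q = 0 by lra.
by rewrite !mul0r addr0 mul0r.
Qed.

(** The posterior minimises the expected squared loss, so benchmarking against any other guess [z]
    can only understate the regret; the resulting bound is linear in [p] and [q]. *)
Lemma cell_regret_ge y z p q : 0 <= p -> 0 <= q ->
  p * ((y - 1) ^+ 2 - (z - 1) ^+ 2) + q * (y ^+ 2 - z ^+ 2) <= cell_regret y p q.
Proof.
move=> p0 q0; rewrite cell_regretE//.
have [pq0|pq0] := eqVneq (p + q) 0.
  have -> : p = 0 by lra.
  have -> : q = 0 by lra.
  by rewrite !mul0r addr0 mul0r.
rewrite -subr_ge0 (_ : _ - _ = (p + q) * (z - p / (p + q)) ^+ 2); last by field.
by rewrite mulr_ge0 ?sqr_ge0// addr_ge0.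
Qed.

(* Evaluating the affine lower bounds of [cell_regret_ge] at the optimal guess
   for the mixture exhibits the regret as a supremum of affine functions. *)
Lemma cell_regret_convex {y p q p' q' t} :
  0 <= p -> 0 <= q -> 0 <= p' -> 0 <= q' -> 0 <= t <= 1 ->
  cell_regret y (t * p + (1 - t) * p') (t * q + (1 - t) * q') <=
    t * cell_regret y p q + (1 - t) * cell_regret y p' q'.
Proof.
move=> p0 q0 p'0 q'0 /andP[t0 t1]; rewrite {1}/cell_regret.
set z := (X in _ - (X - 1) ^+ 2); rewrite -/z.
have h := cell_regret_ge y z p q p0 q0.
have h' := cell_regret_ge y z p' q' p'0 q'0.
have t1' : 0 <= 1 - t by lra.
have := lerD (ler_wpM2l t0 h) (ler_wpM2l t1' h').
by apply: le_trans; rewrite le_eqVlt; apply/orP; left; apply/eqP; ring.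
Qed.

Lemma cell_regret_ge0 {y p q} : 0 <= p -> 0 <= q -> 0 <= cell_regret y p q.
Proof. by move=> p0 q0; rewrite cell_regretE// mulr_ge0 ?sqr_ge0// addr_ge0. Qed.

Lemma cell_regret_le {y p q} : 0 <= y <= 1 -> 0 <= p -> 0 <= q ->
  cell_regret y p q <= p + q.
Proof.
move=> /andP[y0 y1] p0 q0; rewrite cell_regretE// ler_piMr ?addr_ge0//.
have z0 : 0 <= p / (p + q) by rewrite divr_ge0// addr_ge0.
have z1 : p / (p + q) <= 1.
  have [->|pq0] := eqVneq (p + q) 0; first by rewrite invr0 mulr0.
  by rewrite ler_pdivrMr ?mul1r ?lerDl// lt0r pq0 addr_ge0.
move: (p / (p + q)) z0 z1 => z z0 z1; rewrite -subr_ge0.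
rewrite (_ : 1 - _ = (1 - (y - z)) * (1 + (y - z))); last by ring.
by apply: mulr_ge0; lra.
Qed.

End CellRegret.

(** * Regret as a function of the prior, for fixed likelihoods *)

Section PriorRegret.
Context {R : realType} {n1 n2 : nat}.
Context {g1 : bool -> 'I_n1 -> R} {g2 : bool -> 'I_n2 -> R}.
Hypotheses (hg1 : is_likelihood g1) (hg2 : is_likelihood g2).
Implicit Types (F : 'I_n1 -> 'I_n2 -> R) (m t lam : R) (w : bool).

Lemma ci_joint_ge0 {m} w s1 s2 : 0 <= m <= 1 -> 0 <= ci_joint g1 g2 m w s1 s2.
Proof.
move=> /andP[m0 m1]; have [g1_ge0 _] := hg1; have [g2_ge0 _] := hg2.
by rewrite /ci_joint mulr_ge0 ?mulr_ge0//; case: w; rewrite ?subr_ge0.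
Qed.

Lemma ci_joint_sum1 m w s1 :
  \sum_(s2 < n2) ci_joint g1 g2 m w s1 s2 = (if w then m else 1 - m) * g1 w s1.
Proof. by rewrite -mulr_sumr -mulr_sumr hg2.2 mulr1. Qed.

Lemma ci_joint_sum2 m w s2 :
  \sum_(s1 < n1) ci_joint g1 g2 m w s1 s2 = (if w then m else 1 - m) * g2 w s2.
Proof. by rewrite -mulr_sumr -mulr_suml hg1.2 mul1r. Qed.

Lemma ci_joint_sum m w :
  \sum_(s1 < n1) \sum_(s2 < n2) ci_joint g1 g2 m w s1 s2 = if w then m else 1 - m.
Proof.
by rewrite (eq_bigr _ (fun s1 _ => ci_joint_sum1 m w s1)) -mulr_sumr hg1.2 mulr1.
Qed.

Lemma prior_weight_neq0 {m} w : 0 < m < 1 -> (if w then m else 1 - m) != 0.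
Proof. by move=> /andP[m0 m1]; case: w; rewrite gt_eqF// subr_gt0. Qed.

Lemma lik1_ci_joint {m} w s1 : 0 < m < 1 -> lik1 (ci_joint g1 g2 m) w s1 = g1 w s1.
Proof.
move=> hm; rewrite /lik1 /marg1 /pw ci_joint_sum1 ci_joint_sum mulrC mulKf//.
exact: prior_weight_neq0.
Qed.

Lemma lik2_ci_joint {m} w s2 : 0 < m < 1 -> lik2 (ci_joint g1 g2 m) w s2 = g2 w s2.
Proof.
move=> hm; rewrite /lik2 /marg2 /pw ci_joint_sum2 ci_joint_sum mulrC mulKf//.
exact: prior_weight_neq0.
Qed.

Lemma ci_joint_is_ci_info_structure {m} :
  0 < m < 1 -> is_ci_info_structure (ci_joint g1 g2 m).
Proof.
move=> hm; have /andP[m0 m1] := hm; split; last split; last split.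
- by move=> w s1 s2; apply: ci_joint_ge0; rewrite !ltW.
- by rewrite big_bool !ci_joint_sum /=; ring.
- by rewrite /prior /pw ci_joint_sum.
- move=> w s1 s2; rewrite lik1_ci_joint// lik2_ci_joint// /pw ci_joint_sum.
  by rewrite mulrC mulKf// prior_weight_neq0.
Qed.

Lemma exp_regret_ci_joint {f : R -> R -> R} {lam m} : 0 < m < 1 ->
  exp_regret f lam (ci_joint g1 g2 m) =
  prior_regret (fun s1 s2 =>
      f (odds_report (m `^ lam) ((1 - m) `^ lam) (g1 true s1) (g1 false s1))
        (odds_report (m `^ lam) ((1 - m) `^ lam) (g2 true s2) (g2 false s2)))
    g1 g2 m.
Proof.
move=> hm; rewrite /exp_regret big_bool -big_split; apply: eq_bigr => s1 _.
rewrite -big_split; apply: eq_bigr => s2 _.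
rewrite /report1 /report2 !lik1_ci_joint// !lik2_ci_joint//.
by rewrite /prior /pw ci_joint_sum /cell_regret /sqloss /bayes_agg /= !subr0.
Qed.

Lemma prior_regret_convex {F m m' t} :
  0 <= m <= 1 -> 0 <= m' <= 1 -> 0 <= t <= 1 ->
  prior_regret F g1 g2 (t * m + (1 - t) * m') <=
    t * prior_regret F g1 g2 m + (1 - t) * prior_regret F g1 g2 m'.
Proof.
move=> hm hm' ht; rewrite !mulr_sumr -big_split; apply: ler_sum => s1 _.
rewrite !mulr_sumr -big_split; apply: ler_sum => s2 _.
have affine w : ci_joint g1 g2 (t * m + (1 - t) * m') w s1 s2 =
    t * ci_joint g1 g2 m w s1 s2 + (1 - t) * ci_joint g1 g2 m' w s1 s2.
  by rewrite /ci_joint; case: w; ring.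
by rewrite !affine cell_regret_convex// ci_joint_ge0.
Qed.

Lemma prior_regret_ge0 {F m} : 0 <= m <= 1 -> 0 <= prior_regret F g1 g2 m.
Proof.
move=> hm; rewrite sumr_ge0// => s1 _; rewrite sumr_ge0// => s2 _.
by rewrite cell_regret_ge0// ci_joint_ge0.
Qed.

Lemma prior_regret_le1 {F m} : (forall s1 s2, 0 <= F s1 s2 <= 1) ->
  0 <= m <= 1 -> prior_regret F g1 g2 m <= 1.
Proof.
move=> F01 hm; pose P := ci_joint g1 g2 m.
apply: (@le_trans _ _ (\sum_(s1 < n1) \sum_(s2 < n2)
    (P true s1 s2 + P false s1 s2))).
  by apply: ler_sum => s1 _; apply: ler_sum => s2 _;
    rewrite cell_regret_le// ci_joint_ge0.
under eq_bigr do rewrite big_split; rewrite big_split/= !ci_joint_sum.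
by rewrite le_eqVlt; apply/orP; left; apply/eqP; ring.
Qed.

End PriorRegret.

(** Prior and likelihoods are full coordinates for a structure: multiplying the independence
    identity by the positive [pw P w] recovers the joint pmf. *)
Lemma ci_info_structure_joint {R : realType} {n1 n2 : nat}
    {P : bool -> 'I_n1 -> 'I_n2 -> R} : is_ci_info_structure P ->
  [/\ 0 < prior P < 1, is_likelihood (lik1 P), is_likelihood (lik2 P) &
      P = ci_joint (lik1 P) (lik2 P) (prior P)].
Proof.
move=> [P0 [P1 [hprior Pci]]]; have /andP[m0 m1] := hprior.
have pwE w : pw P w = if w then prior P else 1 - prior P.
  case: w => //; move: P1; rewrite big_bool /prior /pw /= => <-; ring.
have pw0 w : 0 < pw P w by rewrite pwE; case: w => //; rewrite subr_gt0.
have marg_ge0 : (forall w s1, 0 <= marg1 P w s1) /\ forall w s2, 0 <= marg2 P w s2.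
  by split=> w s; rewrite sumr_ge0.
split=> //.
- split=> [w s|w]; first by rewrite divr_ge0 ?(ltW (pw0 w))//; case: marg_ge0.
  by rewrite -mulr_suml -/(pw P w) divff// gt_eqF.
- split=> [w s|w]; first by rewrite divr_ge0 ?(ltW (pw0 w))//; case: marg_ge0.
  by rewrite -mulr_suml exchange_big -/(pw P w) divff// gt_eqF.
- apply/funext => w; apply/funext => s1; apply/funext => s2.
  by rewrite /ci_joint -Pci -pwE mulrC divfK// gt_eqF.
Qed.

(** * Powers of the prior odds *)

Section Tilt.
Context {R : realType}.
Implicit Types (m e lam : R).

Lemma odds_reportZ {k : R} a b p q : k != 0 ->
  odds_report (k * a) (k * b) p q = odds_report a b p q.
Proof.
by move=> k0; rewrite /odds_report -(mulrA k a) -(mulrA k b) -mulrDr -mulf_div divff// mul1r.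
Qed.

Lemma odds_report_ge0_le1 {a b p q : R} :
  0 <= a -> 0 <= b -> 0 <= p -> 0 <= q -> 0 <= odds_report a b p q <= 1.
Proof.
move=> a0 b0 p0 q0; have ap := mulr_ge0 a0 p0; have bq := mulr_ge0 b0 q0.
rewrite /odds_report divr_ge0 ?addr_ge0//=.
have [->|n0] := eqVneq (a * p + b * q) 0; first by rewrite invr0 mulr0.
by rewrite ler_pdivrMr ?mul1r ?lerDl// lt0r n0 addr_ge0.
Qed.

Lemma tilt_den_gt0 {e m} : 0 < m < 1 -> 0 < m `^ e + (1 - m) `^ e.
Proof. by move=> /andP[m0 m1]; rewrite addr_gt0// powR_gt0// subr_gt0. Qed.

Lemma onem_tilt {e m} : 0 < m < 1 ->
  1 - tilt e m = (1 - m) `^ e / (m `^ e + (1 - m) `^ e).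
Proof. by move=> hm; have := tilt_den_gt0 (e := e) hm; rewrite /tilt => h; field; lra. Qed.

Lemma tilt_gt0_lt1 {e m} : 0 < m < 1 -> 0 < tilt e m < 1.
Proof.
move=> hm; have /andP[m0 m1] := hm; rewrite -[_ < 1]subr_gt0 onem_tilt//.
by rewrite !divr_gt0 ?tilt_den_gt0 ?powR_gt0 ?subr_gt0.
Qed.

(** The exponents multiply to [lam / lam' * lam' = lam], and the common normalising factor cancels
    from the report. *)
Lemma odds_report_tilt {lam lam' m} p q : 0 < lam' -> 0 < m < 1 ->
  odds_report (tilt (lam / lam') m `^ lam') ((1 - tilt (lam / lam') m) `^ lam') p q
    = odds_report (m `^ lam) ((1 - m) `^ lam) p q.
Proof.
move=> l0 hm; have den0 := tilt_den_gt0 (e := lam / lam') hm.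
have invden0 : 0 <= (m `^ (lam / lam') + (1 - m) `^ (lam / lam'))^-1.
  by rewrite invr_ge0 ltW.
rewrite onem_tilt// /tilt !powRM ?powR_ge0// -!powRrM divfK ?gt_eqF//.
by rewrite ![_ * (_^-1 `^ _)]mulrC odds_reportZ// gt_eqF// powR_gt0// invr_gt0.
Qed.

Lemma tilt1 {m} : 0 < m < 1 -> tilt 1 m = m.
Proof.
by move=> /andP[m0 m1]; rewrite /tilt !powRr1 ?subr_ge0 ?ltW// addrC subrK divr1.
Qed.

(** The logistic form in the log odds makes monotonicity and continuity in [e] visible. *)
Lemma tilt_logistic {e m} : 0 < m < 1 ->
  tilt e m = (1 + expR (e * (ln (1 - m) - ln m)))^-1.
Proof.
move=> hm; have /andP[m0 m1] := hm; have n0 : 0 < 1 - m by rewrite subr_gt0.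
rewrite /tilt /powR !gt_eqF// mulrBr expRD expRN.
have x0 := expR_gt0 (e * ln m); have y0 := expR_gt0 (e * ln (1 - m)).
by field; lra.
Qed.

(** Exponent 1 returns [m], and tilting is monotone in the exponent, in a direction set by whether
    [m] exceeds one half; hence the disjunction. *)
Lemma tilt_between {e e' m} : 0 < m < 1 -> e <= 1 -> 1 <= e' ->
  (tilt e m <= m <= tilt e' m) \/ (tilt e' m <= m <= tilt e m).
Proof.
move=> hm e1 e1'; set c := ln (1 - m) - ln m.
have mono x y : (tilt x m <= tilt y m) = (y * c <= x * c).
  rewrite !tilt_logistic// lef_pV2 ?posrE ?addr_gt0 ?expR_gt0//.
  by rewrite lerD2l ler_expR.
have le_m x : (tilt x m <= m) = (c <= x * c).
  by have := mono x 1; rewrite tilt1// mul1r.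
have ge_m x : (m <= tilt x m) = (x * c <= c).
  by have := mono 1 x; rewrite tilt1// mul1r.
rewrite !le_m !ge_m; have [c0|c0] := leP 0 c; [right|left].
  by rewrite ler_peMl// ler_piMl.
by rewrite ler_neMl ?ler_niMl// ltW.
Qed.

Lemma tilt_continuous {lam m eps} : 0 < lam -> 0 < m < 1 -> 0 < eps ->
  exists2 d, 0 < d & forall lam', `|lam - lam'| < d ->
    `|m - tilt (lam / lam') m| < eps.
Proof.
move=> l0 hm eps0; set c := ln (1 - m) - ln m.
have cont : {for lam, continuous (fun x : R => (1 + expR (lam / x * c))^-1)}.
  apply: cvgV; first by rewrite gt_eqF// addr_gt0// expR_gt0.
  apply: cvgD; first exact: cvg_cst.
  apply: (@continuous_comp _ _ _ (fun x : R => lam / x * c) expR); last exact: continuous_expR.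
  apply: cvgM; last exact: cvg_cst.
  by apply: cvgM; [exact: cvg_cst|apply: cvgV => //; rewrite gt_eqF].
have [d /= d0 hd] := (cvgrPdist_lt _ _).1 cont eps eps0.
exists d => // lam' hlam'; have := hd lam' hlam'.
by rewrite -!tilt_logistic// divff ?gt_eqF// tilt1.
Qed.

End Tilt.

(** * Bounded convex functions on the unit interval *)

Section UnitConvex.
Context {R : realType} {H : R -> R}.
Hypothesis H_convex : forall x y t : R, 0 <= x <= 1 -> 0 <= y <= 1 -> 0 <= t <= 1 ->
  H (t * x + (1 - t) * y) <= t * H x + (1 - t) * H y.
Hypothesis H_unit : forall x : R, 0 <= x <= 1 -> 0 <= H x <= 1.

Lemma convex_le_max {x y z : R} : 0 <= x <= 1 -> 0 <= y <= 1 -> x <= z <= y ->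
  H z <= Num.max (H x) (H y).
Proof.
move=> hx hy /andP[xz zy].
have [xy|xy] := eqVneq x y.
  have -> : z = x by apply/eqP; rewrite eq_le xz xy zy.
  by rewrite le_max lexx.
have yx0 : 0 < y - x by rewrite subr_gt0 lt_neqAle xy (le_trans xz zy).
pose t := (y - z) / (y - x).
have t01 : 0 <= t <= 1.
  by rewrite /t divr_ge0 ?(ltW yx0) ?subr_ge0//= ler_pdivrMr// mul1r lerD2l lerN2.
have -> : z = t * x + (1 - t) * y by rewrite /t; field; lra.
apply: le_trans (H_convex _ _ _ hx hy t01) _.
have /andP[t0 t1] := t01; set M := Num.max _ _.
have xM : H x <= M by rewrite le_max lexx.
have yM : H y <= M by rewrite le_max lexx orbT.
by nra.
Qed.

(* Bounded convexity on the chord from [x] to the far endpoint of [0, 1]. *)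
Lemma convex_lsc {m eps : R} : 0 < m < 1 -> 0 < eps ->
  exists2 d, 0 < d & forall x, 0 <= x <= 1 -> `|m - x| < d -> H m <= H x + eps.
Proof.
(* On the chord the far endpoint has weight |m - x| divided by a length of at least [m] or [1 - m].
   This radius keeps the weight below [eps], and [H] takes values in [0, 1]. *)
move=> /andP[m0 m1] eps0; exists (eps * Num.min m (1 - m)).
  by rewrite mulr_gt0// lt_min m0 subr_gt0.
have chord x z t : 0 <= x <= 1 -> 0 <= z <= 1 -> 0 <= t <= eps -> t <= 1 ->
    m = (1 - t) * x + t * z -> H m <= H x + eps.
  move=> hx hz /andP[t0 teps] t1 mE.
  have ht : 0 <= 1 - t <= 1 by lra.
  have := H_convex _ _ _ hx hz ht; rewrite subKr -mE => /le_trans; apply.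
  by have /andP[? ?] := H_unit _ hx; have /andP[? ?] := H_unit _ hz; nra.
move=> x hx hd; have /andP[x0 x1] := hx.
have hd1 : `|m - x| < eps * m.
  by rewrite (lt_le_trans hd)// ler_pM2l// ge_min lexx.
have hd2 : `|m - x| < eps * (1 - m).
  by rewrite (lt_le_trans hd)// ler_pM2l// ge_min lexx orbT.
have [xm|mx] := leP x m.
  rewrite ger0_norm ?subr_ge0// in hd2.
  apply: (chord x 1 ((m - x) / (1 - x))) => //; first by rewrite ler01 lexx.
  - by rewrite divr_ge0 ?ler_pdivrMr/=; nra.
  - by rewrite ler_pdivrMr; lra.
  - by field; lra.
rewrite ltr0_norm ?subr_lt0// opprB in hd1.
apply: (chord x 0 ((x - m) / x)) => //; first by rewrite ler01 lexx.
- by rewrite divr_ge0 ?ler_pdivrMr/=; nra.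
- by rewrite ler_pdivrMr; lra.
- by field; lra.
Qed.

End UnitConvex.

(** * Quasi-convexity and lower semicontinuity of the worst-case regret *)

Section Regret.
Context {R : realType} {f : R -> R -> R}.
Hypothesis hf : forall x y : R, 0 <= x <= 1 -> 0 <= y <= 1 -> 0 <= f x y <= 1.
Implicit Types (lam M : R).

Lemma report_aggregate_unit {a b p q p' q' : R} :
  0 <= a -> 0 <= b -> 0 <= p -> 0 <= q -> 0 <= p' -> 0 <= q' ->
  0 <= f (odds_report a b p q) (odds_report a b p' q') <= 1.
Proof. by move=> *; apply: hf; apply: odds_report_ge0_le1. Qed.

(** Boundedness makes [regret] a true supremum rather than the default value of [sup]. *)
Lemma exp_regret_le1 {lam n1 n2} {P : bool -> 'I_n1 -> 'I_n2 -> R} :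
  is_ci_info_structure P -> exp_regret f lam P <= 1.
Proof.
move=> /ci_info_structure_joint[hm hg1 hg2 ->].
rewrite exp_regret_ci_joint//; have /andP[m0 m1] := hm.
apply: prior_regret_le1 => //; last by rewrite !ltW.
by move=> s1 s2; apply: report_aggregate_unit;
  rewrite ?powR_ge0//; case: hg1 => ? _; case: hg2.
Qed.

Lemma exp_regret_le_regret {lam n1 n2} {P : bool -> 'I_n1 -> 'I_n2 -> R} :
  is_ci_info_structure P -> exp_regret f lam P <= regret f lam.
Proof.
move=> hP; apply: ub_le_sup; last by exists n1, n2, P.
by exists 1 => _ [k1 [k2 [Q [hQ ->]]]]; exact: exp_regret_le1.
Qed.

Lemma regret_le {lam M} :
  (forall n1 n2 (P : bool -> 'I_n1 -> 'I_n2 -> R),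
     is_ci_info_structure P -> exp_regret f lam P <= M) ->
  regret f lam <= M.
Proof.
move=> hM; apply: ge_sup; last by move=> _ [n1 [n2 [P [hP ->]]]]; exact: hM.
(* The uninformative structure, with one signal per expert and prior 1/2, shows that the set under
   [sup] is nonempty. *)
have g : is_likelihood (fun (_ : bool) (_ : 'I_1) => 1 : R).
  by split=> // _; rewrite big_ord1.
have hm : 0 < (2^-1 : R) < 1 by lra.
have hP := ci_joint_is_ci_info_structure g g hm.
by eexists; do 3 eexists; split; first exact: hP.
Qed.

(* Tilting the prior compensates a change of degree, so the report profile of
   an information structure is available at every degree; [H] is the regret of
   that profile as a function of the prior. *)
Lemma regret_profile {lam n1 n2} {P : bool -> 'I_n1 -> 'I_n2 -> R} :
  is_ci_info_structure P ->
  exists (H : R -> R) (m : R),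
    [/\ forall x y t, 0 <= x <= 1 -> 0 <= y <= 1 -> 0 <= t <= 1 ->
          H (t * x + (1 - t) * y) <= t * H x + (1 - t) * H y,
        forall x, 0 <= x <= 1 -> 0 <= H x <= 1,
        0 < m < 1, exp_regret f lam P = H m &
        forall lam', 0 < lam' -> H (tilt (lam / lam') m) <= regret f lam'].
Proof.
move=> /ci_info_structure_joint[]; move: (lik1 P) (lik2 P) (prior P).
move=> g1 g2 m hm hg1 hg2 ->.
pose F s1 s2 :=
  f (odds_report (m `^ lam) ((1 - m) `^ lam) (g1 true s1) (g1 false s1))
    (odds_report (m `^ lam) ((1 - m) `^ lam) (g2 true s2) (g2 false s2)).
exists (prior_regret F g1 g2), m; split=> //.
- by move=> x y t hx hy ht; exact: prior_regret_convex.
- move=> x hx; rewrite prior_regret_ge0//= prior_regret_le1// => s1 s2.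
  by apply: report_aggregate_unit;
    rewrite ?powR_ge0//; case: hg1 => ? _; case: hg2.
- exact: exp_regret_ci_joint.
move=> lam' l0; have ht := tilt_gt0_lt1 (e := lam / lam') hm.
have := exp_regret_le_regret (lam := lam') (ci_joint_is_ci_info_structure hg1 hg2 ht).
rewrite exp_regret_ci_joint//; congr (_ <= _); congr prior_regret.
by apply/funext => s1; apply/funext => s2; rewrite !odds_report_tilt.
Qed.

(** Since [c / b <= 1 <= c / a], the prior of a structure at degree [c] lies between the tilted
    priors that reproduce its reports at [a] and [b]; convexity bounds its regret by the larger of
    theirs. *)
Lemma regret_quasiconvex {a b c} : 0 < a -> a <= c -> c <= b ->
  regret f c <= Num.max (regret f a) (regret f b).
Proof.
move=> a0 ac cb; have c0 := lt_le_trans a0 ac; have b0 := lt_le_trans c0 cb.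
apply: regret_le => n1 n2 P hP.
have [H [m [Hc Hu hm -> hH]]] := regret_profile (lam := c) hP.
have t01 e : 0 <= tilt e m <= 1.
  by have /andP[? ?] := tilt_gt0_lt1 (e := e) hm; rewrite !ltW.
have e1 : c / b <= 1 by rewrite ler_pdivrMr// mul1r.
have e1' : 1 <= c / a by rewrite ler_pdivlMr// mul1r.
have le_regrets : Num.max (H (tilt (c / a) m)) (H (tilt (c / b) m)) <=
    Num.max (regret f a) (regret f b).
  by rewrite ge_max !le_max !hH// orbT.
apply: le_trans le_regrets.
have [h|h] := tilt_between hm e1 e1'; first rewrite maxC;
  exact: (convex_le_max Hc (t01 _) (t01 _) h).
Qed.

(** Sublevel sets are closed: for degrees near [c] the tilted prior is close to [m], so the regret
    of each structure exceeds [M] by at most an arbitrary [eps]. *)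
Lemma regret_lsc {c M} : 0 < c ->
  (forall d, 0 < d -> exists2 c', 0 < c' & `|c - c'| < d /\ regret f c' <= M) ->
  regret f c <= M.
Proof.
move=> c0 hM; apply: regret_le => n1 n2 P hP.
have [H [m [Hc Hu hm -> hH]]] := regret_profile (lam := c) hP.
apply/ler_addgt0Pr => eps eps0.
have [d d0 hd] := convex_lsc Hc Hu hm eps0.
have [d' d'0 hd'] := tilt_continuous c0 hm d0.
have [c' c'0 [cc' c'M]] := hM _ d'0.
have /andP[t0 t1] := tilt_gt0_lt1 (e := c / c') hm.
apply: le_trans (hd (tilt (c / c') m) _ (hd' _ cc')) _; first by rewrite !ltW.
by rewrite lerD2r (le_trans (hH _ c'0)).
Qed.

End Regret.

(** * Locating the trough *)

Theorem mainTheorem1 (R : realType) (f : R -> R -> R)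
  (hf : forall x y : R, 0 <= x <= 1 -> 0 <= y <= 1 -> 0 <= f x y <= 1) :
  (forall a b : R, 0 < a -> a <= b -> b <= 1 -> regret f b <= regret f a) \/
  (forall a b : R, 0 < a -> a <= b -> b <= 1 -> regret f a <= regret f b) \/
  (exists l0 : R, 0 < l0 <= 1 /\
     (forall a b : R, 0 < a -> a <= b -> b <= l0 -> regret f b <= regret f a) /\
     (forall a b : R, l0 <= a -> a <= b -> b <= 1 -> regret f a <= regret f b)).
Proof.
(* [U] is an up-set on which the regret is non-decreasing by quasi-convexity,
   and off [U] it is non-increasing; the trough is [inf U]. *)
pose U := [set l : R | 0 < l <= 1 /\
  exists2 a, 0 < a <= l & regret f a < regret f l]%classic.
have U_up l b : U l -> l <= b -> b <= 1 -> regret f l <= regret f b.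
  move=> [_ [a /andP[a0 al] lt_al]] lb b1.
  have := regret_quasiconvex hf a0 al lb.
  by rewrite le_max leNgt lt_al.
have notU a b : 0 < a -> a <= b -> b <= 1 -> ~ U b -> regret f b <= regret f a.
  move=> a0 ab b1 nU; rewrite leNgt; apply/negP => lt_ab; apply: nU.
  by split; [rewrite (lt_le_trans a0 ab)|exists a; rewrite ?a0].
have [[u Uu]|U0] := pselect (exists u, U u); last first.
  by left=> a b a0 ab b1; apply: notU => // Ub; apply: U0; exists b.
right; have hinf : has_inf U by split; [exists u|exists 0 => x [/andP[/ltW]]].
have inf_le1 : inf U <= 1.
  by apply: (le_trans (ge_inf hinf.2 Uu)); case: Uu => /andP[].
have above a b : inf U < a -> a <= b -> b <= 1 -> regret f a <= regret f b.
  move=> infa ab b1; have [l Ul la] := inf_lt hinf.1 infa.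
  have [Ua|nUa] := pselect (U a); first exact: U_up.
  have a1 := le_trans ab b1.
  have /andP[l0 _] := Ul.1; have [c /andP[c0 cl] lt_cl] := Ul.2.
  (* [U] is upward closed: the witness [c] for [l] also serves [a], since the regret has not dropped
     between [l] and [a]. *)
  case: nUa; split; first by rewrite (lt_trans l0 la).
  exists c; first by rewrite c0 (le_trans cl (ltW la)).
  by rewrite (lt_le_trans lt_cl)// U_up// ltW.
have below a b : 0 < a -> a <= b -> b < inf U -> regret f b <= regret f a.
  move=> a0 ab binf; apply: notU => //; first by rewrite (le_trans (ltW binf)).
  by move=> /(ge_inf hinf.2); rewrite leNgt binf.
(* Without a positive infimum, [above] covers the whole interval and the regret is
   non-decreasing. *)
have [inf0|inf_gt0] := leP (inf U) 0.
  by left=> a b a0; apply: above; rewrite (le_lt_trans inf0).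
right; exists (inf U); rewrite inf_gt0; split=> //; split=> a b.
(* [below] stops short of [inf U]; lower semicontinuity carries its bound [regret f a] over to the
   limit point. *)
- move=> a0 ab; rewrite le_eqVlt => /predU1P[bE|]; last exact: below.
  rewrite bE in ab *; move: ab; rewrite le_eqVlt => /predU1P[->//|a_inf].
  apply: regret_lsc => // d d0.
  (* A point within [d / 2] to the left of [inf U], but not before [a], so that [below] applies. *)
  exists (Num.max a (inf U - d / 2)); first by rewrite lt_max a0.
  split; last by apply: below; rewrite ?le_max ?lexx// gt_max a_inf; lra.
  by have [h|h] := leP a (inf U - d / 2); rewrite ger0_norm ?subr_ge0; lra.
(* Mirror image: [inf U] may lie outside [U], so its value is bounded through degrees approaching it
   from the right. *)
- rewrite le_eqVlt => /predU1P[<-|]; last exact: above.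
  rewrite le_eqVlt => /predU1P[<-//|inf_b] b1.
  apply: regret_lsc => // d d0.
  exists (Num.min b (inf U + d / 2)); first by rewrite lt_min; lra.
  split; last by apply: above; rewrite ?ge_min ?lexx// lt_min inf_b; lra.
  by rewrite distrC; have [h|h] := leP b (inf U + d / 2);
    rewrite ger0_norm ?subr_ge0; lra.
Qed.
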